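(* Let $\Lambda$ be a finite set with $N$ elements, let $\beta>0$, and for each $m\ge0$ let $U$ be a function on $\Lambda^m$ with values in $\mathbb{R}\cup\{+\infty\}$, invariant under permutations of its arguments, real-valued on $m$-tuples of distinct sites and equal to $+\infty$ on tuples $(y_1,\dots,y_m)$ with $y_i=y_j$ for some $i\ne j$. For $Y_m=(y_1,\dots,y_m)$ and $Y_{m+2}=(y_1,\dots,y_{m+2})$ define $V(Y_m|y_{m+1})$ and $W(Y_m|y_{m+1},y_{m+2})$ to be $+\infty$ when any two of their arguments coincide, and otherwise by $$U(Y_{m+1})=U(Y_m)+V(Y_m|y_{m+1}),\quad U(Y_{m+2})=U(Y_m)+V(Y_m|y_{m+1})+V(Y_m|y_{m+2})+W(Y_m|y_{m+1},y_{m+2}).$$ Let $p_m=\frac{1}{m!}\sum_{Y_m\in\Lambda^m}e^{-\beta U(Y_m)}$ for $0\le m\le N$, $P(z)=\sum_{m=0}^Np_mz^m$, fix $z_0>0$, and let $T_m=m!\,p_mz_0^m/P(z_0)=\frac{z_0^m}{P(z_0)}\sum_{Y_m\in\Lambda^m}e^{-\beta U(Y_m)}$. Writing $F_+=\max\{F,0\}$, define $$D=\sup_{0\le m\le N-2}\ \sup_{Y_{m+1}\in\Lambda^{m+1}}\ \sum_{y_{m+2}\in\Lambda}\bigl(1-e^{-\beta W_+(Y_m|y_{m+1},y_{m+2})}\bigr),\qquad -B=\inf_{0\le m\le N-1}\ \inf_{Y_{m+1}\in\Lambda^{m+1}}V(Y_m|y_{m+1}),$$ where $Y_m$ denotes the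 first $m$ coordinates of $Y_{m+1}$, and assume $D<\infty$ and $-B>-\infty$. Then for $0\le m\le N-2$, $$T_{m+1}^2-T_mT_{m+2}\le z_0e^{\beta B}D\,T_mT_{m+1}.$$
   Context: Conventions: $e^{-\infty}=0$; $W_+(\cdot)=+\infty$ when $W=+\infty$, so that $1-e^{-\beta W_+}=1$ in that case. *)

(* Defs.v *)
From HB Require Import structures.
From mathcomp Require Export all_boot all_order all_algebra.
From mathcomp Require Export all_classical all_reals all_analysis.

Set Implicit Arguments.
Unset Strict Implicit.
Unset Printing Implicit Defensive.

Import Order.TTheory GRing.Theory Num.Theory.
Local Open Scope ring_scope.

(* [fine] is harmless whenever [x != -oo]: [expeR -oo = 0], and
   [expeR (- (beta%:E * x))] is then finite for [0 < beta]. *)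
Definition boltz (R : realType) (beta : R) (x : \bar R) : R :=
  fine (expeR (- (beta%:E * x))%E).

Section Lattice.
Variables (R : realType) (L : finType).
Variable U : forall m : nat, m.-tuple L -> \bar R.

Definition ext m (Y : m.-tuple L) (y : L) : m.+1.-tuple L :=
  [tuple of rcons Y y].

Definition V m (Y : m.-tuple L) (y : L) : \bar R :=
  if uniq (ext Y y) then (U (ext Y y) - U Y)%E else +oo%E.

Definition W m (Y : m.-tuple L) (y y' : L) : \bar R :=
  if uniq (ext (ext Y y) y')
  then (U (ext (ext Y y) y') - (U Y + V Y y + V Y y'))%E
  else +oo%E.

Definition p (beta : R) (m : nat) : R :=
  (m`!%:R)^-1 * \sum_(Y : m.-tuple L) boltz beta (U Y).

Definition P (beta z : R) : R :=
  \sum_(0 <= m < #|L|.+1) p beta m * z ^+ m.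

Definition T (beta z0 : R) (m : nat) : R :=
  m`!%:R * p beta m * z0 ^+ m / P beta z0.

(* An (m+1)-tuple is written as its first m coordinates [Y] followed by its
   last coordinate [y].  As in the source, tuples with repeated entries are
   included; for them [W = +oo] and each summand is 1. *)
Definition D (beta : R) : \bar R :=
  ereal_sup [set s | exists m (Y : m.-tuple L) (y : L), (m.+2 <= #|L|)%N /\
    s = (\sum_(y' : L) (1 - boltz beta (maxe (W Y y y') 0%E)))%:E]%classic.

Definition B : \bar R :=
  (- ereal_inf [set v | exists m (Y : m.-tuple L) (y : L),
       (m.+1 <= #|L|)%N /\ v = V Y y]%classic)%E.

Hypothesis U_fin :
  forall m (Y : m.-tuple L), uniq Y -> U Y \is a fin_num.

Lemma V_def m (Y : m.-tuple L) (y : L) :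
  uniq (ext Y y) -> U (ext Y y) = (U Y + V Y y)%E.
Proof.
move=> uYy; rewrite /V uYy addeC subeK// U_fin//.
by move: uYy; rewrite /= rcons_uniq => /andP[].
Qed.

Lemma W_def m (Y : m.-tuple L) (y y' : L) : uniq (ext (ext Y y) y') ->
  U (ext (ext Y y) y') = (U Y + V Y y + V Y y' + W Y y y')%E.
Proof.
move=> u; rewrite /W u addeC subeK//.
move: (u); rewrite /= !rcons_uniq mem_rcons inE negb_or.
move=> /andP[/andP[_ y'Y] /andP[yY uY]].
have uy : uniq (ext Y y) by rewrite /= rcons_uniq yY uY.
have uy' : uniq (ext Y y') by rewrite /= rcons_uniq y'Y uY.
by rewrite -V_def// /V uy' !(fin_numD, fin_numN) !U_fin.
Qed.

End Lattice.

Lemma TE (R : realType) (L : finType) (U : forall m, m.-tuple L -> \bar R)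
    (beta z0 : R) (m : nat) :
  T U beta z0 m =
  z0 ^+ m / P U beta z0 * \sum_(Y : m.-tuple L) boltz beta (U m Y).
Proof.
have f0 : (m`!%:R : R) != 0 by rewrite pnatr_eq0 -lt0n fact_gt0.
by rewrite /T /p mulrA divff// mul1r -mulrA mulrC.
Qed.

(* Main.v *)
From mathcomp Require Import ring lra.
Require Import Defs.
Import Order.TTheory GRing.Theory Num.Theory.
Local Open Scope ring_scope.

(** Write [S m] for the sum of [exp (- beta U)] over [m]-tuples.  Peeling off the
    last coordinate, [S (m+1)] is the sum, with weight [exp (- beta U Y)], of
    [a Y = \sum_y exp (- beta V Y y)], so Cauchy-Schwarz bounds [S (m+1) ^ 2] by
    [S m] times the weighted sum of [(a Y) ^ 2].  Peeling off two coordinates,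
    [S (m+2)] is the same weighted sum with [(a Y) ^ 2] replaced by
    [\sum_y \sum_y' exp (- beta (V Y y + V Y y' + W Y y y'))].  The difference
    carries the factor [1 - exp (- beta W)], which is at most
    [1 - exp (- beta W_+)]; bounding [exp (- beta V Y y')] by [exp (beta B)] and
    summing over [y'] produces [exp (beta B) D]. *)

(** Lagrange's identity: the nonnegative double sum of [b i * b j * (a i - a j) ^+ 2] is twice the
    right side minus the left. Weights may vanish, as they do on tuples with repeated sites. *)
Lemma weighted_cauchy_schwarz {R : realType} {I : finType} (b a : I -> R) :
  (forall i, 0 <= b i) ->
  (\sum_i b i * a i) ^+ 2 <= (\sum_i b i) * (\sum_i b i * a i ^+ 2).
Proof.
move=> b0; set A := \sum_i _ * a _; set S := \sum_i b i; set Q := \sum_i _ * _.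
have: 0 <= \sum_i \sum_j b i * b j * (a i - a j) ^+ 2.
  apply: sumr_ge0 => i _; apply: sumr_ge0 => j _.
  by rewrite mulr_ge0 ?sqr_ge0 ?mulr_ge0.
suff -> : \sum_i \sum_j b i * b j * (a i - a j) ^+ 2 =
    Q * S - 2 * (A * A) + S * Q by rewrite expr2; lra.
have inner i : \sum_j b i * b j * (a i - a j) ^+ 2 =
    b i * a i ^+ 2 * S - 2 * (b i * a i * A) + b i * Q.
  rewrite /S /A /Q !mulr_sumr -sumrN -!big_split/=.
  by apply: eq_bigr => j _; ring.
under eq_bigr do rewrite inner.
by rewrite !big_split/= sumrN -mulr_sumr -!mulr_suml.
Qed.

Lemma sum_tuple_rcons {R : realType} {L : finType} (m : nat)
    (F : m.+1.-tuple L -> R) :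
  \sum_(Y : m.+1.-tuple L) F Y = \sum_(Y : m.-tuple L) \sum_(y : L) F (ext Y y).
Proof.
rewrite pair_big/= (reindex (fun q : m.-tuple L * L => ext q.1 q.2))//=.
apply: onW_bij; apply: inj_card_bij.
  move=> [Y y] [Y' y'] /= /(congr1 val)/= /rcons_inj[eY ->].
  by congr pair; apply: val_inj.
by rewrite card_prod !card_tuple expnSr.
Qed.

Section Boltzmann.
Context {R : realType} {beta : R}.
Hypothesis beta_gt0 : 0 < beta.

Lemma boltz_fin (r : R) : boltz beta r%:E = expR (- (beta * r)).
Proof. by []. Qed.

Lemma boltz_pinfty : boltz beta +oo%E = 0.
Proof. by rewrite /boltz gt0_muley ?lte_fin. Qed.

Lemma boltz_ge0 (x : \bar R) : 0 <= boltz beta x.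
Proof. by rewrite /boltz fine_ge0 ?expeR_ge0. Qed.

Lemma boltzD (x y : \bar R) : x != -oo%E -> y != -oo%E ->
  boltz beta (x + y)%E = boltz beta x * boltz beta y.
Proof.
case: x => [r| |]; case: y => [s| |] // _ _; last 3 first.
- by rewrite addey// boltz_pinfty mulr0.
- by rewrite addye// boltz_pinfty mul0r.
- by rewrite addye// boltz_pinfty mul0r.
by rewrite -EFinD !boltz_fin mulrDr opprD expRD.
Qed.

(** At [x = -oo] this would fail: [fine] sends the infinite exponential to 0. *)
Lemma boltz_le (x y : \bar R) :
  x != -oo%E -> (x <= y)%E -> boltz beta y <= boltz beta x.
Proof.
case: x => [r| |]; case: y => [s| |] // _; rewrite ?boltz_pinfty ?boltz_ge0//.
by rewrite lee_fin !boltz_fin ler_expR lerN2 ler_pM2l.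
Qed.

Lemma boltz_max0_le (x : \bar R) : x != -oo%E ->
  boltz beta (maxe x 0%E) <= boltz beta x.
Proof. by move=> xNy; rewrite boltz_le// le_max lexx. Qed.

Lemma boltz_max0_le1 (x : \bar R) : boltz beta (maxe x 0%E) <= 1.
Proof.
rewrite -[leRHS](_ : boltz beta 0%:E = 1); last by rewrite boltz_fin mulr0 oppr0 expR0.
by rewrite boltz_le// le_max lexx orbT.
Qed.

End Boltzmann.

Section Interaction.
Context {R : realType} {L : finType} {beta : R}.
Hypothesis beta_gt0 : 0 < beta.
Variable U : forall m : nat, m.-tuple L -> \bar R.
Hypothesis U_fin : forall m (Y : m.-tuple L), uniq Y -> U m Y \is a fin_num.
Hypothesis U_oo : forall m (Y : m.-tuple L), ~~ uniq Y -> U m Y = +oo%E.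

Let fin_neq (x : \bar R) : x \is a fin_num -> x != -oo%E.
Proof. by rewrite fin_numE => /andP[]. Qed.

Lemma U_neqNy m (Y : m.-tuple L) : U m Y != -oo%E.
Proof. by have [/U_fin/fin_neq|/U_oo->] := boolP (uniq Y). Qed.

Lemma V_fin_num m (Y : m.-tuple L) y :
  uniq (ext Y y) -> V U Y y \is a fin_num.
Proof.
move=> u; rewrite /V u fin_numD fin_numN !U_fin//.
by move: u; rewrite /= rcons_uniq => /andP[].
Qed.

Lemma V_neqNy m (Y : m.-tuple L) y : V U Y y != -oo%E.
Proof.
have [/V_fin_num/fin_neq//|/negbTE nu] := boolP (uniq (ext Y y)).
by rewrite /V nu.
Qed.

Lemma W_neqNy m (Y : m.-tuple L) y y' : W U Y y y' != -oo%E.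
Proof.
rewrite /W; case: ifPn => // u; apply: fin_neq.
move: (u); rewrite /= !rcons_uniq mem_rcons inE negb_or.
move=> /andP[/andP[_ y'Y] /andP[yY uY]].
by rewrite !(fin_numD, fin_numN) !V_fin_num ?U_fin//= rcons_uniq ?yY ?y'Y.
Qed.

(** On a repeated site [U] and [V] are both [+oo], so both sides vanish; the factorisation thus
    holds on all tuples and sums need no restriction to distinct sites. *)
Lemma boltz_U_ext m (Y : m.-tuple L) y :
  boltz beta (U _ (ext Y y)) = boltz beta (U m Y) * boltz beta (V U Y y).
Proof.
have [u|nu] := boolP (uniq (ext Y y)).
  by rewrite (V_def U_fin)// boltzD ?U_neqNy ?V_neqNy.
by rewrite U_oo// /V (negbTE nu) boltz_pinfty// mulr0.
Qed.

Lemma boltz_U_ext2 m (Y : m.-tuple L) y y' :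
  boltz beta (U _ (ext (ext Y y) y')) =
  boltz beta (U m Y) *
    (boltz beta (V U Y y) * boltz beta (V U Y y') * boltz beta (W U Y y y')).
Proof.
have [u|nu] := boolP (uniq (ext (ext Y y) y')).
  rewrite (W_def U_fin)// !boltzD ?mulrA//;
    by rewrite ?adde_eq_ninfty ?negb_or ?U_neqNy ?V_neqNy ?W_neqNy.
by rewrite U_oo// /W (negbTE nu) boltz_pinfty// !mulr0.
Qed.

Lemma pair_defect_le m (Y : m.-tuple L) (e d : R) :
  (forall y, boltz beta (V U Y y) <= e) ->
  (forall y, \sum_y' (1 - boltz beta (maxe (W U Y y y') 0%E)) <= d) ->
  (\sum_y boltz beta (V U Y y)) ^+ 2 -
    \sum_y \sum_y'
      boltz beta (V U Y y) * boltz beta (V U Y y') * boltz beta (W U Y y y')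
  <= e * d * \sum_y boltz beta (V U Y y).
Proof.
move=> Ve Wd.
rewrite expr2 mulr_suml mulr_sumr -sumrB; apply: ler_sum => y _.
rewrite mulr_sumr -sumrB [leRHS]mulrC.
under eq_bigr do rewrite -mulrA -mulrBr -[X in X - _]mulr1 -mulrBr.
rewrite -mulr_sumr ler_wpM2l ?boltz_ge0//.
(* The sign of [e] comes from the Boltzmann factor it dominates. *)
have e0 : 0 <= e := le_trans (boltz_ge0 _) (Ve y).
apply: le_trans (ler_wpM2l e0 (Wd y)); rewrite mulr_sumr.
apply: ler_sum => y' _.
(* The order matters: [1 - boltz beta W] may be negative, so [W] is first replaced by its positive
   part; the factor is then nonnegative and [boltz beta (V U Y y')] can be raised to [e]. *)
apply: (@le_trans _ _ (boltz beta (V U Y y') *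
                       (1 - boltz beta (maxe (W U Y y y') 0%E)))).
  by rewrite ler_wpM2l ?boltz_ge0// lerB// boltz_max0_le// W_neqNy.
by rewrite ler_wpM2r// subr_ge0 boltz_max0_le1.
Qed.

Let S m : R := \sum_(Y : m.-tuple L) boltz beta (U m Y).

Lemma partition_turan_le m (e d : R) :
  (forall (Y : m.-tuple L) y, boltz beta (V U Y y) <= e) ->
  (forall (Y : m.-tuple L) y,
     \sum_y' (1 - boltz beta (maxe (W U Y y y') 0%E)) <= d) ->
  S m.+1 ^+ 2 - S m * S m.+2 <= e * d * (S m * S m.+1).
Proof.
move=> Ve Wd.
have S1E : S m.+1 =
    \sum_(Y : m.-tuple L) boltz beta (U m Y) * \sum_y boltz beta (V U Y y).
  rewrite /S sum_tuple_rcons; apply: eq_bigr => Y _; rewrite mulr_sumr.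
  by apply: eq_bigr => y _; rewrite boltz_U_ext.
have S2E : S m.+2 = \sum_(Y : m.-tuple L) boltz beta (U m Y) * \sum_y \sum_y'
    boltz beta (V U Y y) * boltz beta (V U Y y') * boltz beta (W U Y y y').
  rewrite /S !sum_tuple_rcons; apply: eq_bigr => Y _; rewrite mulr_sumr.
  apply: eq_bigr => y _; rewrite mulr_sumr.
  by apply: eq_bigr => y' _; rewrite boltz_U_ext2.
have CS : S m.+1 ^+ 2 <= S m * \sum_(Y : m.-tuple L)
    boltz beta (U m Y) * (\sum_y boltz beta (V U Y y)) ^+ 2.
  by rewrite S1E; apply: weighted_cauchy_schwarz => Y; exact: boltz_ge0.
(* After Cauchy-Schwarz both sides carry the factor [S m]; removing it leaves the average of
   [pair_defect_le] over [Y]. *)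
apply: le_trans (lerB CS (lexx _)) _.
rewrite -mulrBr mulrCA ler_wpM2l//; first by apply: sumr_ge0 => *; exact: boltz_ge0.
rewrite S1E S2E -sumrB mulr_sumr; apply: ler_sum => Y _.
by rewrite -mulrBr mulrCA ler_wpM2l ?boltz_ge0 ?pair_defect_le.
Qed.

(** The bound for [S] is multiplied by the square of [z ^+ m.+1 / P]. The left products have total
    degree [2m+2] in [z], but [T m * T m.+1] only [2m+1], whence the extra [z]. *)
Lemma T_turan_le (z : R) m (e d : R) :
  (forall (Y : m.-tuple L) y, boltz beta (V U Y y) <= e) ->
  (forall (Y : m.-tuple L) y,
     \sum_y' (1 - boltz beta (maxe (W U Y y y') 0%E)) <= d) ->
  T U beta z m.+1 ^+ 2 - T U beta z m * T U beta z m.+2 <=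
  z * e * d * (T U beta z m * T U beta z m.+1).
Proof.
move=> Ve Wd; rewrite !TE -!/(S _).
have c0 : 0 <= (z ^+ m.+1 / P U beta z) ^+ 2 by exact: sqr_ge0.
have := ler_wpM2l c0 (partition_turan_le _ _ _ Ve Wd).
by congr (_ <= _); rewrite !exprS; ring.
Qed.

(** The infimum is not [+oo] because adding one site to the empty tuple has finite [V]. *)
Lemma B_fin_num : (0 < #|L|)%N -> (-oo < - B U)%E -> B U \is a fin_num.
Proof.
move=> /card_gt0P[y _] hB; rewrite -fin_numN fin_numE -ltNye hB /B oppeK.
apply/eqP => infy.
have /V_fin_num : uniq (ext [tuple] y) by [].
suff : (+oo <= V U [tuple] y)%E by rewrite leye_eq => /eqP ->.
rewrite -infy; apply: ereal_inf_lbound; exists 0%N, [tuple], y; split=> //.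
by apply/card_gt0P; exists y.
Qed.

Lemma boltz_V_le m (Y : m.-tuple L) y : (m < #|L|)%N ->
  B U \is a fin_num -> boltz beta (V U Y y) <= expR (beta * fine (B U)).
Proof.
move=> mL Bfin.
have -> : expR (beta * fine (B U)) = boltz beta (- B U)%E.
  by rewrite -[in RHS](fineK Bfin) -EFinN boltz_fin mulrN opprK.
apply: boltz_le => //; first by apply: fin_neq; rewrite fin_numN.
by rewrite /B oppeK; apply: ereal_inf_lbound; exists m, Y, y.
Qed.

Lemma le_D m (Y : m.-tuple L) y : (m.+2 <= #|L|)%N ->
  ((\sum_y' (1 - boltz beta (maxe (W U Y y y') 0%E)))%:E <= D U beta)%E.
Proof. by move=> mL; apply: ereal_sup_ubound; exists m, Y, y. Qed.

(** With two sites the supremum runs over a nonempty set of reals, so it is not [-oo]. *)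
Lemma D_fin_num : (1 < #|L|)%N -> (D U beta < +oo)%E -> D U beta \is a fin_num.
Proof.
move=> L2 hD; have /card_gt0P[y _] := ltnW L2.
rewrite fin_numE -ltey hD andbT -ltNye.
exact: lt_le_trans (ltNyr _) (le_D _ [tuple] y L2).
Qed.

End Interaction.

Theorem theoremB2 (R : realType) (L : finType) (N : nat) (hN : #|L| = N)
  (beta : R) (hbeta : 0 < beta)
  (U : forall m : nat, m.-tuple L -> \bar R)
  (U_sym : forall (m : nat) (Y Y' : m.-tuple L),
     perm_eq Y Y' -> U m Y = U m Y')
  (U_fin : forall (m : nat) (Y : m.-tuple L), uniq Y -> U m Y \is a fin_num)
  (U_oo : forall (m : nat) (Y : m.-tuple L), ~~ uniq Y -> U m Y = +oo%E)
  (z0 : R) (hz0 : 0 < z0)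
  (hD : (D U beta < +oo)%E)
  (hB : (-oo < - B U)%E)
  (m : nat) (hm : (m + 2 <= N)%N) :
  ((T U beta z0 m.+1 ^+ 2 - T U beta z0 m * T U beta z0 m.+2)%:E
   <= z0%:E * expeR (beta%:E * B U) * D U beta
      * (T U beta z0 m * T U beta z0 m.+1)%:E)%E.
Proof.
have L2 : (m.+2 <= #|L|)%N by rewrite hN -addn2.
have Bfin := B_fin_num _ U_fin (leq_trans (isT : (0 < m.+2)%N) L2) hB.
have Dfin := D_fin_num _ (leq_trans (isT : (1 < m.+2)%N) L2) hD.
(* Finiteness reduces the goal to real numbers, with [e = expR (beta * fine (B U))] and
   [d = fine (D U beta)]. *)
rewrite -(fineK Bfin) -(fineK Dfin) -!EFinM lee_fin.
apply: (T_turan_le hbeta _ U_fin U_oo) => // Y y.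
  by apply: boltz_V_le => //; exact: ltnW.
by rewrite -lee_fin fineK// le_D.
Qed.
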